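(* Let $(X,d)$ be a semimetric space and assume that for some $\alpha\in(0,1]$ there exists a mapping $F\colon X\to Y$ which is a bi-Lipschitz embedding of $(X,d^{\alpha})$ into a metric space $(Y,d_Y)$. Then $(X,d)$ is a $b$-metric space.
   Context: A semimetric space is a pair $(X,d)$ with $X\neq\emptyset$ and $d\colon X\times X\to[0,+\infty)$ such that for all $x,y\in X$: $d(x,y)=0\iff x=y$, and $d(x,y)=d(y,x)$. A $b$-metric space is a semimetric space $(X,d)$ for which there exists $K\geqslant 1$ with $d(x,z)\leqslant K\left(d(x,y)+d(y,z)\right)$ for all $x,y,z\in X$. Here $d^{\alpha}(x,y)=(d(x,y))^{\alpha}$. A map $F\colon X\to Y$ is a bi-Lipschitz embedding of $(X,d^{\alpha})$ into $(Y,d_Y)$ if there is a constant $C>0$ such that $C^{-1} d^{\alpha}(x,y)\leqslant d_Y(F(x),F(y))\leqslant C\, d^{\alpha}(x,y)$ for all $x,y\in X$. *)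

(* Defs.v *)
From mathcomp Require Import all_boot all_order all_algebra.
From mathcomp Require Import all_classical all_reals all_analysis.

Set Implicit Arguments.
Unset Strict Implicit.
Unset Printing Implicit Defensive.

Import Order.TTheory GRing.Theory Num.Theory.

Local Open Scope ring_scope.

Definition semimetric (R : realType) (X : Type) (d : X -> X -> R) : Prop :=
  [/\ inhabited X,
      forall x y, 0 <= d x y,
      forall x y, d x y = 0 <-> x = y
    & forall x y, d x y = d y x].

Definition b_metric (R : realType) (X : Type) (d : X -> X -> R) : Prop :=
  semimetric d /\
  exists2 K : R, 1 <= K & forall x y z, d x z <= K * (d x y + d y z).

(* For [0 < a], [powR 0 a = 0], so this vanishes exactly where [d] does. *)
Definition dist_pow (R : realType) (X : Type) (d : X -> X -> R) (a : R) :
  X -> X -> R := fun x y => d x y `^ a.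

Definition bilipschitz_embedding (R : realType) (X Y : Type)
    (dX : X -> X -> R) (dY : Y -> Y -> R) (F : X -> Y) : Prop :=
  exists2 C : R, 0 < C &
    forall x y, C^-1 * dX x y <= dY (F x) (F y) <= C * dX x y.

(* Main.v *)
(* The triangle inequality in Y gives
   d^a(x,z) <= C^2 (d^a(x,y) + d^a(y,z)) <= 2 C^2 (d(x,y) + d(y,z))^a,
   and raising to the power 1/a yields K = 1 + (2 C^2)^(1/a), where
   the summand 1 only ensures K >= 1. *)
Require Import Defs.
From mathcomp Require Import all_boot all_order all_algebra.
From mathcomp Require Import all_classical all_reals all_analysis.
From mathcomp Require Import ring.

Set Implicit Arguments.
Unset Strict Implicit.
Unset Printing Implicit Defensive.

Import Order.TTheory GRing.Theory Num.Theory.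

Local Open Scope ring_scope.

Theorem theorem4p1 (R : realType) (X : Type) (d : X -> X -> R) :
  semimetric d ->
  (exists alpha : R, 0 < alpha <= 1 /\
    exists (Y : metricType R) (F : X -> Y),
      bilipschitz_embedding (dist_pow d alpha) (@mdist R Y) F) ->
  b_metric d.
Proof.
move=> sd [a [/andP[a0 _] [Y [F [C C0 HF]]]]]; split=> //.
have [_ d0 _ _] := sd.
pose M := 2 * C ^+ 2.
have M0 : 0 <= M by rewrite mulr_ge0// exprn_ge0// ltW.
exists (1 + M `^ a^-1); first by rewrite lerDl powR_ge0.
move=> x y z; set s := d x y + d y z.
have s0 : 0 <= s by rewrite addr_ge0.
have quasi : d x z `^ a <= M * s `^ a.
  have /andP[lxz _] := HF x z.
  have /andP[_ uxy] := HF x y.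
  have /andP[_ uyz] := HF y z.
  rewrite /dist_pow in lxz uxy uyz.
  have mono t : 0 <= t -> t <= s -> t `^ a <= s `^ a.
    by move=> t0 ts; rewrite ge0_ler_powR// ltW.
  (* Both distances are at most [s], so each power is bounded by the same s^a; adding the two bounds
     produces the factor 2 in [M]. *)
  have xy : d x y `^ a <= s `^ a by rewrite mono// lerDl.
  have yz : d y z `^ a <= s `^ a by rewrite mono// lerDr.
  (* The triangle inequality passes through [F y]. One [C] comes from the upper bounds; clearing
     [C^-1] below gives the other. *)
  have : C^-1 * d x z `^ a <= C * (s `^ a + s `^ a).
    apply: (le_trans lxz); apply: (le_trans (metric_triangle _ (F y) _)).
    rewrite mulrDr lerD//; [apply: (le_trans uxy)|apply: (le_trans uyz)];
    by rewrite ler_pM2l.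
  by rewrite ler_pdivrMl//; congr (_ <= _); rewrite /M; ring.
(* The sign condition matters: [powR] takes a default value at negative bases. *)
have rootK t : 0 <= t -> (t `^ a) `^ a^-1 = t.
  by move=> t0; rewrite -powRrM mulfV ?gt_eqF// powRr1.
have : (d x z `^ a) `^ a^-1 <= (M * s `^ a) `^ a^-1.
  by apply: ge0_ler_powR; rewrite ?nnegrE ?invr_ge0 ?mulr_ge0 ?powR_ge0// ltW.
(* The root splits over the nonnegative factors [M] and s^a, leaving M^(1/a) times [s]. *)
rewrite powRM ?powR_ge0// !rootK// => /le_trans; apply.
by rewrite ler_wpM2r// lerDr.
Qed.
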